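(* Let $\vec a(s_a)$ and $\vec b(s_b)$ be two Cartan framed null curves in Minkowski 3-space $E_1^3$, with curvatures $\kappa_a$ and $\kappa_b$. Then $\vec a(s_a)$ and $\vec b(s_b)$ are null similar curves with variable transformation if and only if $\vec a(s_a)$ and $\vec b(s_b)$ are null Bertrand curves with the particular variable transformation $\lambda_b^a=\dfrac{\kappa_b}{\kappa_a}$.
   Context: $E_1^3$ is $\mathbb R^3$ with the Lorentz metric $\langle\cdot,\cdot\rangle=-dx_1^2+dx_2^2+dx_3^2$ and vector product $\vec x\times\vec y=(x_2y_3-x_3y_2,\;x_1y_3-x_3y_1,\;x_2y_1-x_1y_2)$. A vector $\vec v\neq0$ is null if $\langle\vec v,\vec v\rangle=0$; a curve is null if all its velocity vectors are null. A Cartan framed null curve (null Frenet curve) $\vec a=\vec a(s)$ is a curve admitting a frame field $\{\vec\alpha,\vec\gamma,\vec\beta\}$ and functions $\kappa$ (curvature), $\tau$ (torsion) with $\vec\alpha=d\vec a/ds$, $\langle\vec\alpha,\vec\alpha\rangle=\langle\vec\gamma,\vec\gamma\rangle=0$, $\langle\vec\beta,\vec\beta\rangle=\langle\vec\alpha,\vec\gamma\rangle=1$, $\vec\beta=\vec\alpha\times\vec\gamma$, and $\vec\alpha'=\kappa\vec\beta$, $\vec\gamma'=\tau\vec\beta$, $\vec\beta'=-\tau\vec\alpha-\kappa\vec\gamma$, where $'=d/ds$. The parameter $s$ is called the arc length parameter. Subscripts $a$, $b$ indicate the data of $\vec a(s_a)$, $\vec b(s_b)$. Null similar curves with variable transformation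 $\lambda_b^a$: $\vec a(s_a)$ and $\vec b(s_b)$ are so called if there exists a variable transformation $s_a=\int\lambda_b^a(s_b)\,ds_b$ of the arc lengths such that $\vec\alpha_a(s_a)=\vec\alpha_b(s_b)$ for all corresponding values of the parameters. Null Bertrand pair (null Bertrand curves): a pair $(\vec a,\vec b)$ of Cartan framed null curves for which the vector fields $\vec\beta_a$ and $\vec\beta_b$ are linearly dependent.
   Formalization: The printed converse fails for some null helices with β_a = −β_b; the Bertrand side therefore also requires β_a = β_b (not just linear dependence) when τ_b is a constant multiple of κ_b. The curvature κ_a is assumed nowhere zero. *)

(* Defs.v *)
From Stdlib Require Import Reals.
From Coquelicot Require Import Coquelicot.
Open Scope R_scope.

(* R^3 is Coquelicot's product normed module, so that [is_derive] applies
   directly to vector-valued functions of a real variable. *)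
Notation E13 := (R * R * R)%type.

Definition x1 (v : E13) : R := fst (fst v).
Definition x2 (v : E13) : R := snd (fst v).
Definition x3 (v : E13) : R := snd v.

Definition lorentz (x y : E13) : R :=
  - (x1 x * x1 y) + x2 x * x2 y + x3 x * x3 y.

Definition cross (x y : E13) : E13 :=
  (x2 x * x3 y - x3 x * x2 y,
   x1 x * x3 y - x3 x * x1 y,
   x2 x * x1 y - x1 x * x2 y).

(* The curve lives on the open interval ]lo, hi[, possibly unbounded; the
   values of the functions outside of it are irrelevant.  That the curve is
   null (and alpha is nonzero) follows from the relations below. *)
Record cartan_null_curve := CartanNullCurve {
  lo : Rbar;
  hi : Rbar;
  pos : R -> E13;
  alpha : R -> E13;
  gamma : R -> E13;
  beta : R -> E13;
  kappa : R -> R;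
  tau : R -> R;
  lo_lt_hi : Rbar_lt lo hi;
  pos_deriv : forall s : R, Rbar_lt lo s -> Rbar_lt s hi ->
    is_derive pos s (alpha s);
  alpha_null : forall s : R, Rbar_lt lo s -> Rbar_lt s hi ->
    lorentz (alpha s) (alpha s) = 0;
  gamma_null : forall s : R, Rbar_lt lo s -> Rbar_lt s hi ->
    lorentz (gamma s) (gamma s) = 0;
  beta_unit : forall s : R, Rbar_lt lo s -> Rbar_lt s hi ->
    lorentz (beta s) (beta s) = 1;
  alpha_gamma : forall s : R, Rbar_lt lo s -> Rbar_lt s hi ->
    lorentz (alpha s) (gamma s) = 1;
  beta_cross : forall s : R, Rbar_lt lo s -> Rbar_lt s hi ->
    beta s = cross (alpha s) (gamma s);
  alpha_deriv : forall s : R, Rbar_lt lo s -> Rbar_lt s hi ->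
    is_derive alpha s (scal (kappa s) (beta s));
  gamma_deriv : forall s : R, Rbar_lt lo s -> Rbar_lt s hi ->
    is_derive gamma s (scal (tau s) (beta s));
  beta_deriv : forall s : R, Rbar_lt lo s -> Rbar_lt s hi ->
    is_derive beta s
      (minus (opp (scal (tau s) (alpha s))) (scal (kappa s) (gamma s)))
}.

Definition dom (c : cartan_null_curve) (s : R) : Prop :=
  Rbar_lt (lo c) s /\ Rbar_lt s (hi c).

(* s_a = phi s_b, where phi is an indefinite integral of lambda: a C^1 change
   of parameter from the whole interval of b onto the whole interval of a.
   As lambda is continuous and never 0, phi is injective; lambda may be
   negative, since kappa is a signed function. *)
Definition variable_transformation
    (a b : cartan_null_curve) (phi lambda : R -> R) : Prop :=
  (forall t, dom b t ->
     is_derive phi t (lambda t) /\ continuous lambda t /\ lambda t <> 0) /\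
  (forall t, dom b t -> dom a (phi t)) /\
  (forall s, dom a s -> exists t, dom b t /\ phi t = s).

Definition null_similar (a b : cartan_null_curve) : Prop :=
  exists phi lambda : R -> R,
    variable_transformation a b phi lambda /\
    forall t, dom b t -> alpha a (phi t) = alpha b t.

Definition linearly_dependent (u v : E13) : Prop :=
  exists p q : R, (p <> 0 \/ q <> 0) /\ plus (scal p u) (scal q v) = zero.

Definition null_bertrand_pair
    (a b : cartan_null_curve) (phi : R -> R) : Prop :=
  forall t, dom b t -> linearly_dependent (beta a (phi t)) (beta b t).

Definition null_helix (c : cartan_null_curve) : Prop :=
  exists r : R, forall s, dom c s -> tau c s = r * kappa c s.

(* For null helices, linear dependence of the beta fields does not suffice:
   if tau b = - kappa b / r with r constant, then alpha := r gamma_b,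
   gamma := alpha_b / r, beta := - beta_b is the frame of another Cartan framed
   null curve a with kappa a = kappa b (phi = id, lambda = 1), and a, b need not
   be similar.  In this case the frames are required to agree in orientation. *)
Definition helix_oriented
    (a b : cartan_null_curve) (phi : R -> R) : Prop :=
  null_helix b -> forall t, dom b t -> beta a (phi t) = beta b t.

(* Main.v *)
(** Let (A, G, B) and (A', G', B') be two null frames with B' = e B. The triple
    product formula v x (A x G) = <v,A> G - <v,G> A, applied to v = A', gives
    e A' = <A',G> A - <A',A> G, since A' x B' = - A'. Pairing with the first frame
    leaves two cases: either e = 1 and A' = m A, or e = -1 and A' = c G.

    If the curves are similar, then A' = A forces e = 1, and differentiating
    A' = A yields lambda kappa_a = kappa_b. Conversely, c = <alpha_a, alpha_b> has
    zero derivative, hence is constant, so that the same case holds along the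
    whole curve. Differentiating <alpha_a, beta_b> = 0 gives
    e kappa_b = c tau_b + m kappa_b: for e = 1 this is m = 1, i.e. similarity, and
    for e = -1 it says that b is a null helix, where the orientation hypothesis
    excludes e = -1. *)
Require Import Defs.
From Stdlib Require Import Reals Lra.
From Coquelicot Require Import Coquelicot.
Open Scope R_scope.

(** * Algebra of the Lorentz product and the vector product *)

Lemma E13_ext (u v : E13) : x1 u = x1 v -> x2 u = x2 v -> x3 u = x3 v -> u = v.
Proof.
destruct u as [[u1 u2] u3], v as [[v1 v2] v3]; unfold x1, x2, x3; simpl.
now intros -> -> ->.
Qed.

Lemma lorentz_sym (u v : E13) : lorentz u v = lorentz v u.
Proof. unfold lorentz; ring. Qed.

Lemma lorentz_scal_l (k : R) (u v : E13) :
  lorentz (scal k u) v = k * lorentz u v.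
Proof.
unfold lorentz, x1, x2, x3; simpl; unfold scal, mult; simpl; unfold mult; simpl.
ring.
Qed.

Lemma lorentz_scal_r (k : R) (u v : E13) :
  lorentz u (scal k v) = k * lorentz u v.
Proof. now rewrite lorentz_sym, lorentz_scal_l, lorentz_sym. Qed.

Lemma lorentz_minus_l (u v w : E13) :
  lorentz (minus u v) w = lorentz u w - lorentz v w.
Proof.
unfold lorentz, x1, x2, x3, minus; simpl; unfold plus, opp; simpl; ring.
Qed.

Lemma lorentz_minus_r (u v w : E13) :
  lorentz u (minus v w) = lorentz u v - lorentz u w.
Proof. now rewrite lorentz_sym, lorentz_minus_l, !(lorentz_sym u). Qed.

Lemma lorentz_opp_r (u v : E13) : lorentz u (opp v) = - lorentz u v.
Proof.
unfold lorentz, x1, x2, x3; simpl; unfold opp; simpl; ring.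
Qed.

Lemma lorentz_cross_l (u v : E13) : lorentz u (cross u v) = 0.
Proof. unfold lorentz, cross, x1, x2, x3; simpl; ring. Qed.

(** Lagrange identity; the Lorentzian signature reverses the Euclidean sign, here and in
    [cross_triple]. *)
Lemma lorentz_cross_cross (u v : E13) :
  lorentz (cross u v) (cross u v)
  = lorentz u v * lorentz u v - lorentz u u * lorentz v v.
Proof. unfold lorentz, cross, x1, x2, x3; simpl; ring. Qed.

Lemma cross_scal_r (k : R) (u v : E13) :
  cross u (scal k v) = scal k (cross u v).
Proof.
apply E13_ext; unfold cross, x1, x2, x3; simpl; unfold scal, mult; simpl;
  unfold mult; simpl; ring.
Qed.

Lemma cross_triple (u v w : E13) :
  cross u (cross v w) = minus (scal (lorentz u v) w) (scal (lorentz u w) v).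
Proof.
apply E13_ext; unfold lorentz, cross, x1, x2, x3, minus; simpl;
  unfold plus, opp, scal, mult; simpl; unfold mult; simpl; ring.
Qed.

(** Pairing the relation with [v] shows that [p = 0] would force [q = 0]. So [u] is a multiple of
    [v], and comparing norms makes the square of the factor 1. *)
Lemma linearly_dependent_unit (u v : E13) :
  lorentz u u = 1 -> lorentz v v = 1 -> linearly_dependent u v ->
  exists e : R, (e = 1 \/ e = -1) /\ u = scal e v.
Proof.
intros Hu Hv (p & q & Hpq & H).
assert (E : forall w, p * lorentz u w + q * lorentz v w = 0).
{ intros w. rewrite <- !lorentz_scal_l.
  replace 0 with (lorentz (plus (scal p u) (scal q v)) w).
  - unfold lorentz, x1, x2, x3; simpl; unfold plus; simpl; ring.
  - rewrite H; unfold lorentz, x1, x2, x3; simpl; unfold zero; simpl; ring. }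
assert (Hp : p <> 0).
{ intros ->. generalize (E v); rewrite Hv. intros. destruct Hpq; lra. }
assert (Huv : u = scal (- q / p) v).
{ assert (K : forall x y : R, p * x + q * y = 0 -> x = - q / p * y).
  { intros x y K. apply Rmult_eq_reg_l with p; [|exact Hp].
    replace (p * (- q / p * y)) with (- q * y) by (field; exact Hp). lra. }
  apply E13_ext; apply K.
  - exact (f_equal x1 H).
  - exact (f_equal x2 H).
  - exact (f_equal x3 H). }
exists (- q / p); split; [|exact Huv].
generalize Hu; rewrite Huv, lorentz_scal_l, lorentz_scal_r, Hv. intros K.
assert (F : (- q / p - 1) * (- q / p + 1) = 0) by lra.
apply Rmult_integral in F; destruct F; [left | right]; lra.
Qed.

(** * Two null frames with proportional [B] vectors *)

(** The pointwise, derivative-free part of a Cartan frame, so that the frames of two curves can be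
    compared at a single parameter. *)
Definition null_frame (A G B : E13) : Prop :=
  lorentz A A = 0 /\ lorentz G G = 0 /\ lorentz A G = 1 /\ B = cross A G.

Lemma null_frame_unit (A G B : E13) : null_frame A G B -> lorentz B B = 1.
Proof.
intros (HA & HG & HAG & ->). rewrite lorentz_cross_cross, HA, HAG; ring.
Qed.

(** The product [cross A' B'] is computed twice: in its own frame it is [- A'], and through
    [B' = e B] the triple product formula expands it in [A] and [G]. Since [e] is its own inverse,
    it can be moved to the other side. *)
Lemma null_frame_proportional (A G B A' G' B' : E13) (e : R) :
  null_frame A G B -> null_frame A' G' B' -> B' = scal e B ->
  e = 1 \/ e = -1 ->
  scal e A' = minus (scal (lorentz A' G) A) (scal (lorentz A' A) G).
Proof.
intros (_ & _ & _ & HB) (HA' & _ & HAG' & HB') HBB He.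
assert (H1 : cross A' B' = scal (-1) A').
{ rewrite HB', cross_triple, HA', HAG'.
  apply E13_ext; unfold x1, x2, x3, minus; simpl;
    unfold plus, opp, scal, mult; simpl; unfold mult; simpl; ring. }
rewrite HBB, cross_scal_r, HB, cross_triple in H1.
assert (K : forall x y : R, e * x = -1 * y -> e * y = - x).
{ intros x y H; destruct He; subst; lra. }
apply E13_ext.
- apply (f_equal x1) in H1; apply K in H1; etransitivity; [exact H1|].
  unfold x1, minus; simpl; unfold plus, opp; simpl; ring.
- apply (f_equal x2) in H1; apply K in H1; etransitivity; [exact H1|].
  unfold x2, minus; simpl; unfold plus, opp; simpl; ring.
- apply (f_equal x3) in H1; apply K in H1; etransitivity; [exact H1|].
  unfold x3, minus; simpl; unfold plus, opp; simpl; ring.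
Qed.

Lemma null_frame_orth (B A' G' B' : E13) (e : R) :
  null_frame A' G' B' -> B' = scal e B -> e = 1 \/ e = -1 ->
  lorentz A' B = 0.
Proof.
intros (_ & _ & _ & HB') HBB He.
assert (H : lorentz A' B' = 0) by (rewrite HB'; apply lorentz_cross_l).
rewrite HBB, lorentz_scal_r in H. destruct He; subst; lra.
Qed.

(** Pairing the expansion of [A'] with [A] gives [<A',A> = - <A',A>], so the [G] component
    vanishes. *)
Lemma null_frame_same_side (A G B A' G' B' : E13) :
  null_frame A G B -> null_frame A' G' B' -> B' = scal 1 B ->
  lorentz A' A = 0 /\ A' = scal (lorentz A' G) A.
Proof.
intros F F' HBB.
pose proof (null_frame_proportional _ _ _ _ _ _ _ F F' HBB (or_introl eq_refl))
  as H.
rewrite (scal_one A' : scal 1 A' = A') in H.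
destruct F as (HA & _ & HAG & _).
assert (c0 : lorentz A' A = 0).
{ generalize (f_equal (fun v => lorentz v A) H); simpl.
  rewrite lorentz_minus_l, !lorentz_scal_l, HA, (lorentz_sym G), HAG. lra. }
split; [exact c0|].
rewrite c0 in H.
rewrite H at 1.
apply E13_ext; unfold x1, x2, x3, minus; simpl;
  unfold plus, opp, scal, mult; simpl; unfold mult; simpl; ring.
Qed.

(** Pairing the expansion of [- A'] with [G] gives [- <A',G> = <A',G>]. If [<A',A>] vanished too,
    [A'] would be zero, against [<A',G'> = 1]. *)
Lemma null_frame_opposite_side (A G B A' G' B' : E13) :
  null_frame A G B -> null_frame A' G' B' -> B' = scal (-1) B ->
  lorentz A' A <> 0 /\ lorentz A' G = 0.
Proof.
intros F F' HBB.
pose proof (null_frame_proportional _ _ _ _ _ _ _ F F' HBB (or_intror eq_refl))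
  as H.
destruct F as (_ & HG & HAG & _), F' as (_ & _ & HAG' & _).
assert (m0 : lorentz A' G = 0).
{ generalize (f_equal (fun v => lorentz v G) H); simpl.
  rewrite lorentz_minus_l, !lorentz_scal_l, HG, HAG. lra. }
split; [|exact m0].
intros c0. generalize (f_equal (fun v => lorentz v G') H); simpl.
rewrite lorentz_minus_l, !lorentz_scal_l, c0, m0, HAG'. lra.
Qed.

(** * Differentiation of [E13]-valued functions *)

(** Chain rule, a bounded linear map being its own differential; applied to the coordinate
    projections. *)
Lemma is_derive_linear {V W : NormedModule R_AbsRing} (l : V -> W)
    (f : R -> V) (t : R) (df : V) :
  is_linear l -> is_derive f t df -> is_derive (fun s => l (f s)) t (l df).
Proof.
intros Hl Hf.
apply (filterdiff_ext_lin _ (fun y : R => l (scal y df))).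
- apply filterdiff_comp; [exact Hf | now apply filterdiff_linear].
- intros y. apply (linear_scal l Hl).
Qed.

Lemma is_derive_coord (f : R -> E13) (t : R) (df : E13) :
  is_derive f t df ->
  is_derive (fun s => x1 (f s)) t (x1 df) /\
  is_derive (fun s => x2 (f s)) t (x2 df) /\
  is_derive (fun s => x3 (f s)) t (x3 df).
Proof.
intros H; unfold x1, x2, x3.
assert (H12 : is_derive (fun s => fst (f s)) t (fst df)).
{ exact (is_derive_linear _ _ _ _ is_linear_fst H). }
split; [|split].
- exact (is_derive_linear _ _ _ _ is_linear_fst H12).
- exact (is_derive_linear _ _ _ _ is_linear_snd H12).
- exact (is_derive_linear _ _ _ _ is_linear_snd H).
Qed.

Lemma is_derive_E13_unique (f : R -> E13) (t : R) (u v : E13) :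
  is_derive f t u -> is_derive f t v -> u = v.
Proof.
intros Hu Hv.
destruct (is_derive_coord _ _ _ Hu) as (u1 & u2 & u3).
destruct (is_derive_coord _ _ _ Hv) as (v1 & v2 & v3).
apply is_derive_unique in u1, u2, u3, v1, v2, v3.
apply E13_ext; congruence.
Qed.

Lemma is_derive_lorentz (f g : R -> E13) (t : R) (df dg : E13) :
  is_derive f t df -> is_derive g t dg ->
  is_derive (fun s => lorentz (f s) (g s)) t
    (lorentz df (g t) + lorentz (f t) dg).
Proof.
intros Hf Hg.
destruct (is_derive_coord _ _ _ Hf) as (f1 & f2 & f3).
destruct (is_derive_coord _ _ _ Hg) as (g1 & g2 & g3).
pose proof (is_derive_mult _ _ _ _ _ f1 g1 Rmult_comm) as P1.
pose proof (is_derive_mult _ _ _ _ _ f2 g2 Rmult_comm) as P2.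
pose proof (is_derive_mult _ _ _ _ _ f3 g3 Rmult_comm) as P3.
pose proof (is_derive_plus _ _ _ _ _
  (is_derive_plus _ _ _ _ _ (is_derive_opp _ _ _ P1) P2) P3) as P.
evar_last; [exact P|].
unfold lorentz; simpl; unfold plus, opp, mult; simpl; ring.
Qed.

(** * Curves over their parameter interval *)

Lemma locally_dom (c : cartan_null_curve) (t : R) :
  dom c t -> locally t (dom c).
Proof.
intros [H1 H2]. apply filter_and.
- exact (open_Rbar_gt' t (lo c) H1).
- exact (open_Rbar_lt' t (hi c) H2).
Qed.

Lemma dom_null_derive_const (c : cartan_null_curve) (f : R -> R) :
  (forall t, dom c t -> is_derive f t 0) ->
  forall s t, dom c s -> dom c t -> f s = f t.
Proof.
intros Hf.
assert (K : forall s t, dom c s -> dom c t -> s < t -> f s = f t).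
{ intros s t [Hs _] [_ Ht] Hst. apply eq_is_derive; [|exact Hst].
  intros u [Hsu Hut]. apply Hf; split.
  - exact (Rbar_lt_le_trans _ (Finite s) (Finite u) Hs Hsu).
  - exact (Rbar_le_lt_trans (Finite u) (Finite t) _ Hut Ht). }
intros s t Hs Ht.
destruct (Rtotal_order s t) as [H | [-> | H]]; [now apply K | easy |].
symmetry; now apply K.
Qed.

Lemma cartan_null_frame (c : cartan_null_curve) (s : R) :
  dom c s -> null_frame (alpha c s) (gamma c s) (beta c s).
Proof.
intros [H1 H2]. unfold null_frame.
now rewrite alpha_null, gamma_null, alpha_gamma, <- beta_cross.
Qed.

Lemma alpha_comp_deriv (a b : cartan_null_curve) (phi lambda : R -> R) (t : R) :
  variable_transformation a b phi lambda -> dom b t ->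
  is_derive (fun s => alpha a (phi s)) t
    (scal (lambda t * kappa a (phi t)) (beta a (phi t))).
Proof.
intros (Hphi & Hdom & _) Ht.
destruct (Hphi t Ht) as [D _]. destruct (Hdom t Ht) as [H1 H2].
evar_last.
- exact (is_derive_comp _ _ _ _ _ (alpha_deriv a (phi t) H1 H2) D).
- exact (scal_assoc (lambda t) (kappa a (phi t)) (beta a (phi t))).
Qed.

(** * From similar curves to a Bertrand pair *)

Lemma null_similar_bertrand (a b : cartan_null_curve) (phi lambda : R -> R) :
  (forall s, dom a s -> kappa a s <> 0) ->
  variable_transformation a b phi lambda ->
  (forall t, dom b t -> alpha a (phi t) = alpha b t) ->
  forall t, dom b t ->
    beta a (phi t) = beta b t /\ lambda t = kappa b t / kappa a (phi t).
Proof.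
intros Hk HV Hsim t Ht.
pose proof HV as (Hphi & Hdom & _).
destruct (Hphi t Ht) as (_ & _ & Hl).
pose proof (Hk _ (Hdom t Ht)) as Hka.
pose proof (cartan_null_frame b t Ht) as Fb.
pose proof (cartan_null_frame a _ (Hdom t Ht)) as Fa.
pose proof (null_frame_unit _ _ _ Fa) as Ua.
pose proof (null_frame_unit _ _ _ Fb) as Ub.
(* Both sides are the derivative of the common tangent field at [t]; similarity holds near [t]
   because [dom b] is open. *)
assert (E : scal (lambda t * kappa a (phi t)) (beta a (phi t))
            = scal (kappa b t) (beta b t)).
{ apply (is_derive_E13_unique (alpha b) t).
  - apply (is_derive_ext_loc (fun s => alpha a (phi s))).
    + exact (filter_imp _ _ Hsim (locally_dom b t Ht)).
    + exact (alpha_comp_deriv a b phi lambda t HV Ht).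
  - exact (alpha_deriv b t (proj1 Ht) (proj2 Ht)). }
assert (Hlk : lambda t * kappa a (phi t) <> 0).
{ now apply Rmult_integral_contrapositive_currified. }
assert (LD : linearly_dependent (beta a (phi t)) (beta b t)).
{ exists (lambda t * kappa a (phi t)), (- kappa b t).
  split; [now left|]. rewrite E.
  apply E13_ext; unfold x1, x2, x3; simpl;
    unfold plus, zero, scal, mult; simpl; unfold mult; simpl; ring. }
destruct (linearly_dependent_unit _ _ Ua Ub LD) as (e & He & HB).
(* For [e = -1] the two tangents would have nonzero product, but they are one and the same null
   vector. *)
assert (e = 1) as ->.
{ destruct He as [He | He]; [exact He|]. subst e.
  destruct (null_frame_opposite_side _ _ _ _ _ _ Fb Fa HB) as [N _].
  exfalso; apply N. rewrite (Hsim t Ht). apply Fb. }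
assert (HB1 : beta a (phi t) = beta b t).
{ rewrite HB. apply (scal_one (beta b t)). }
split; [exact HB1|].
(* Pairing with the unit vector [beta b t] turns the vector identity into
   [lambda kappa_a = kappa_b]. *)
apply (f_equal (fun v => lorentz v (beta b t))) in E.
rewrite HB1, !lorentz_scal_l, Ub in E.
apply Rmult_eq_reg_r with (kappa a (phi t)); [|exact Hka].
replace (kappa b t / kappa a (phi t) * kappa a (phi t)) with (kappa b t)
  by (field; exact Hka).
lra.
Qed.

(** * From a Bertrand pair to similar curves *)

Lemma bertrand_null_similar (a b : cartan_null_curve) (phi lambda : R -> R) :
  (forall s, dom a s -> kappa a s <> 0) ->
  variable_transformation a b phi lambda ->
  null_bertrand_pair a b phi ->
  (forall t, dom b t -> lambda t = kappa b t / kappa a (phi t)) ->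
  helix_oriented a b phi ->
  forall t, dom b t -> alpha a (phi t) = alpha b t.
Proof.
intros Hk HV HBP Hlam Hor.
pose proof HV as (Hphi & Hdom & _).
assert (Hkb : forall t, dom b t -> lambda t * kappa a (phi t) = kappa b t).
{ intros t Ht. rewrite Hlam by exact Ht. field. now apply Hk, Hdom. }
assert (Hkb0 : forall t, dom b t -> kappa b t <> 0).
{ intros t Ht. rewrite <- Hkb by exact Ht.
  apply Rmult_integral_contrapositive_currified.
  - apply (Hphi t Ht).
  - now apply Hk, Hdom. }
assert (Fb := cartan_null_frame b).
assert (Fa := fun t Ht => cartan_null_frame a (phi t) (Hdom t Ht)).
(* At this stage the sign [e] may still vary with [t]. *)
assert (Hside : forall t, dom b t -> exists e, (e = 1 \/ e = -1) /\
  beta a (phi t) = scal e (beta b t)).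
{ intros t Ht. apply linearly_dependent_unit; [| |exact (HBP t Ht)].
  - exact (null_frame_unit _ _ _ (Fa t Ht)).
  - exact (null_frame_unit _ _ _ (Fb t Ht)). }
assert (Horth : forall t, dom b t -> lorentz (alpha a (phi t)) (beta b t) = 0).
{ intros t Ht. destruct (Hside t Ht) as (e & He & HB).
  exact (null_frame_orth _ _ _ _ _ (Fa t Ht) HB He). }
(* The derivative is [lambda kappa_a <beta_a, alpha_b> + kappa_b <alpha_a, beta_b>]; both products
   vanish, as [beta_a] is a multiple of [beta_b]. *)
assert (Hconst : forall s t, dom b s -> dom b t ->
  lorentz (alpha a (phi s)) (alpha b s) = lorentz (alpha a (phi t)) (alpha b t)).
{ apply (dom_null_derive_const b
    (fun s => lorentz (alpha a (phi s)) (alpha b s))).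
  intros t Ht. evar_last.
  - apply is_derive_lorentz; [exact (alpha_comp_deriv _ _ _ _ _ HV Ht)|].
    exact (alpha_deriv b t (proj1 Ht) (proj2 Ht)).
  - destruct (Hside t Ht) as (e & _ & HB).
    destruct (Fb t Ht) as (_ & _ & _ & HBb).
    rewrite lorentz_scal_l, lorentz_scal_r, (Horth t Ht), HB, lorentz_scal_l.
    rewrite (lorentz_sym (beta b t)).
    rewrite HBb, lorentz_cross_l. ring. }
(* Obtained by differentiating [Horth], with [lambda kappa_a] replaced by [kappa_b]. *)
assert (Hrel : forall t e, dom b t -> beta a (phi t) = scal e (beta b t) ->
  e * kappa b t = tau b t * lorentz (alpha a (phi t)) (alpha b t)
                  + kappa b t * lorentz (alpha a (phi t)) (gamma b t)).
{ intros t e Ht HB.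
  assert (D0 : is_derive (fun s => lorentz (alpha a (phi s)) (beta b s)) t 0).
  { apply (is_derive_ext_loc (fun _ => 0)); [|apply @is_derive_const].
    apply (filter_imp (F := locally t) (dom b)); [|now apply locally_dom].
    intros s Hs; symmetry; exact (Horth s Hs). }
  pose proof (is_derive_lorentz _ _ _ _ _ (alpha_comp_deriv _ _ _ _ _ HV Ht)
    (beta_deriv b t (proj1 Ht) (proj2 Ht))) as D.
  apply is_derive_unique in D0, D. rewrite D0 in D.
  rewrite lorentz_scal_l, Hkb, HB, lorentz_scal_l, lorentz_minus_r,
    lorentz_opp_r, !lorentz_scal_r, (null_frame_unit _ _ _ (Fb t Ht)) in D
    by exact Ht.
  lra. }
intros t Ht. destruct (Hside t Ht) as (e & He & HB).
destruct He as [-> | ->].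
- destruct (null_frame_same_side _ _ _ _ _ _ (Fb t Ht) (Fa t Ht) HB)
    as [c0 HA].
  pose proof (Hrel t 1 Ht HB) as R1. rewrite c0 in R1.
  assert (m1 : lorentz (alpha a (phi t)) (gamma b t) = 1).
  { apply Rmult_eq_reg_l with (kappa b t); [lra | now apply Hkb0]. }
  rewrite m1 in HA. rewrite HA. exact (scal_one (alpha b t)).
- destruct (null_frame_opposite_side _ _ _ _ _ _ (Fb t Ht) (Fa t Ht) HB)
    as [c_neq0 _].
  set (c := lorentz (alpha a (phi t)) (alpha b t)) in *.
  assert (helix : null_helix b).
  { exists (- / c). intros s Hs. destruct (Hside s Hs) as (e & He & HBs).
    pose proof (Hconst s t Hs Ht) as Hc; fold c in Hc.
    destruct He as [-> | ->].
    (* A point with [e = 1] would give [c = 0], so the sign cannot switch along the curve. *)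
    - destruct (null_frame_same_side _ _ _ _ _ _ (Fb s Hs) (Fa s Hs) HBs)
        as [c0 _].
      congruence.
    - destruct (null_frame_opposite_side _ _ _ _ _ _ (Fb s Hs) (Fa s Hs) HBs)
        as [_ m0].
      pose proof (Hrel s (-1) Hs HBs) as R1. rewrite Hc, m0 in R1.
      apply Rmult_eq_reg_r with c; [|exact c_neq0].
      replace (- / c * kappa b s * c) with (- kappa b s)
        by (field; exact c_neq0).
      lra. }
  (* The orientation hypothesis now reads [- beta_b = beta_b], impossible for a unit vector. *)
  exfalso. pose proof (Hor helix t Ht) as HB1. rewrite HB in HB1.
  apply (f_equal (fun v => lorentz v (beta b t))) in HB1.
  rewrite lorentz_scal_l, (null_frame_unit _ _ _ (Fb t Ht)) in HB1. lra.
Qed.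

Theorem corollary3p1 (a b : cartan_null_curve)
    (kappa_a_neq0 : forall s : R, dom a s -> kappa a s <> 0) :
  null_similar a b <->
  exists phi lambda : R -> R,
    variable_transformation a b phi lambda /\
    null_bertrand_pair a b phi /\
    (forall t : R, dom b t -> lambda t = kappa b t / kappa a (phi t)) /\
    helix_oriented a b phi.
Proof.
split.
- intros (phi & lambda & HV & Hsim).
  pose proof (null_similar_bertrand a b phi lambda kappa_a_neq0 HV Hsim) as H.
  exists phi, lambda. split; [exact HV|]. split; [|split].
  + intros t Ht. exists 1, (-1). split; [left; lra|].
    rewrite (proj1 (H t Ht)).
    apply E13_ext; unfold x1, x2, x3; simpl;
      unfold plus, zero, scal, mult; simpl; unfold mult; simpl; ring.
  + intros t Ht. apply (H t Ht).
  + intros _ t Ht. apply (H t Ht).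
- intros (phi & lambda & HV & HBP & Hlam & Hor).
  exists phi, lambda. split; [exact HV|].
  now apply (bertrand_null_similar a b phi lambda).
Qed.
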